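(* Let $A\in\mathbb{R}^{m\times n}$, let $k\le n$ be a positive integer, let $0<q\le 1$ and $p>0$, and suppose $h_{p,q}(A,k)<1$. Let $x^*\in\mathbb{R}^n$ and let $y$ be a solution (global minimizer) of $$\min_{x\in\mathbb{R}^n}\|x\|_{h_{p,q}}\quad\text{s.t. }Ax=Ax^* .$$ Then $$\|x^*-y\|_{h_{p,q}}\le\frac{2\left(1+h_{p,q}(A,k)\right)}{1-h_{p,q}(A,k)}\,\|\sigma(x^* )\|_{h_{p,q}},$$ where $\sigma(x^* )=x^*_{S^c}$ and $S$ is an index set of $k$ entries of $x^*$ that are largest in absolute value.
   Context: For $p>0$ and $0<q\le 1$ let $h_{p,q}(t)=\log\left(1+|t|^q/p\right)$ for $t\in\mathbb{R}$, and for $x\in\mathbb{R}^n$ let $\|x\|_{h_{p,q}}=\sum_{i=1}^n h_{p,q}(x_i)$. $N(A)=\{x\in\mathbb{R}^n: Ax=0\}$. For an index set $S\subseteq\{1,\dots,n\}$, $x_S\in\mathbb{R}^n$ equals $x$ on $S$ and is zero elsewhere, and $S^c$ is the complement of $S$. The $h_{p,q}$-null space constant $h_{p,q}(A,k)$ is the smallest number $c\ge 0$ (with $c=+\infty$ if no finite one exists) such that $\|x_S\|_{h_{p,q}}\le c\,\|x_{S^c}\|_{h_{p,q}}$ for every non-zero $x\in N(A)$ and every $S\subseteq\{1,\dots,n\}$ with $|S|\le k$. *)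

(* Defs.v *)
From HB Require Import structures.
From mathcomp Require Import all_boot all_order all_algebra.
From mathcomp Require Import all_classical all_reals all_analysis.

Set Implicit Arguments.
Unset Strict Implicit.
Unset Printing Implicit Defensive.

Import Order.TTheory GRing.Theory Num.Theory.

Local Open Scope classical_set_scope.
Local Open Scope ring_scope.

Definition hfun (R : realType) (p q t : R) : R := ln (1 + `|t| `^ q / p).

(* Written ||x||_h in the mathematics, although it is not homogeneous. *)
Definition hnorm (R : realType) (p q : R) (n : nat) (x : 'cV[R]_n) : R :=
  \sum_(i < n) hfun p q (x i 0).

Definition restr (R : realType) (n : nat) (S : {set 'I_n}) (x : 'cV[R]_n) :
    'cV[R]_n :=
  \col_(i < n) (if i \in S then x i 0 else 0).

Definition nsc_bound (R : realType) (p q : R) (m n : nat) (A : 'M[R]_(m, n))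
    (k : nat) (c : R) : Prop :=
  forall (x : 'cV[R]_n) (S : {set 'I_n}),
    A *m x = 0 -> x != 0 -> (#|S| <= k)%N ->
    hnorm p q (restr S x) <= c * hnorm p q (restr (~: S) x).

(* The admissible constants form a closed set bounded below by 0, so the
   infimum is the smallest one when there is one, and it is +oo otherwise. *)
Definition null_space_constant (R : realType) (p q : R) (m n : nat)
    (A : 'M[R]_(m, n)) (k : nat) : \bar R :=
  ereal_inf [set c%:E | c in [set c : R | 0 <= c /\ nsc_bound p q A k c]].

Definition is_minimizer (R : realType) (p q : R) (m n : nat)
    (A : 'M[R]_(m, n)) (b : 'cV[R]_m) (y : 'cV[R]_n) : Prop :=
  A *m y = b /\
  forall z : 'cV[R]_n, A *m z = b -> hnorm p q y <= hnorm p q z.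

(* With ties several sets qualify. *)
Definition largest_entries (R : realType) (n : nat) (x : 'cV[R]_n) (k : nat)
    (S : {set 'I_n}) : Prop :=
  #|S| = k /\
  forall i j : 'I_n, i \in S -> j \notin S -> `|x j 0| <= `|x i 0|.

(* Main.v *)
Require Import Defs.
From HB Require Import structures.
From mathcomp Require Import all_boot all_order all_algebra.
From mathcomp Require Import all_classical all_reals all_analysis.
From mathcomp Require Import lra.

Import Order.TTheory GRing.Theory Num.Theory.

Local Open Scope ring_scope.

(** The function [h] is even, vanishes at 0 and is subadditive, so [hnorm]
    obeys the triangle inequality on every coordinate set. Let [u = xs - y],
    which lies in the kernel of [A]. Minimality of [y] gives
    [||y_S|| + ||y_{S^c}|| <= ||xs_S|| + ||xs_{S^c}||], hence
    [||u_{S^c}|| <= ||u_S|| + 2 ||xs_{S^c}||], and [||u_S|| <= c ||u_{S^c}||]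
    because the infimum [c] defining the null space constant is attained. *)

Lemma powRD_subadditive (R : realType) (a b q : R) :
  0 <= a -> 0 <= b -> 0 < q -> q <= 1 -> (a + b) `^ q <= a `^ q + b `^ q.
Proof.
move=> a0 b0 q0 q1.
have [ab0|ab0] := eqVneq (a + b) 0.
  by rewrite ab0 powR0 ?gt_eqF// addr_ge0// powR_ge0.
have s0 : 0 < a + b by rewrite lt_neqAle eq_sym ab0 addr_ge0.
(* For [0 <= x <= s], [x / s <= (x / s) ^ q]; the ratios for [a] and [b] sum
   to 1. *)
have ratio x : 0 <= x -> x <= a + b ->
    x / (a + b) * (a + b) `^ q <= x `^ q.
  move=> x0 xs.
  have {2}-> : x = x / (a + b) * (a + b) by rewrite divfK.
  rewrite powRM ?divr_ge0 ?(ltW s0)// ler_wpM2r ?powR_ge0//.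
  have [->|xn0] := eqVneq x 0; first by rewrite mul0r powR_ge0.
  rewrite ger1_powR// divr_gt0//=; last by rewrite lt_neqAle eq_sym xn0.
  by rewrite ler_pdivrMr// mul1r.
have -> : (a + b) `^ q =
    a / (a + b) * (a + b) `^ q + b / (a + b) * (a + b) `^ q.
  by rewrite -mulrDl -mulrDl divff// mul1r.
by rewrite lerD// ratio// ?lerDl ?lerDr.
Qed.

Lemma hfun_ge0 (R : realType) (p q t : R) : 0 < p -> 0 <= hfun p q t.
Proof. by move=> p0; rewrite ln_ge0// lerDl divr_ge0 ?powR_ge0 ?ltW. Qed.

Lemma hfun0 (R : realType) (p q : R) : 0 < q -> hfun p q 0 = 0.
Proof. by move=> q0; rewrite /hfun normr0 powR0 ?gt_eqF// mul0r addr0 ln1. Qed.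

Lemma hfunN (R : realType) (p q t : R) : hfun p q (- t) = hfun p q t.
Proof. by rewrite /hfun normrN. Qed.

(** The sum of logarithms is the logarithm of [(1 + a) * (1 + b)], with [a] and [b] the two scaled
    powers. This product exceeds [1 + a + b] by the cross term [a * b >= 0], and [1 + a + b]
    dominates the left argument by subadditivity of the power. *)
Lemma hfunD (R : realType) (p q s t : R) : 0 < q -> q <= 1 -> 0 < p ->
  hfun p q (s + t) <= hfun p q s + hfun p q t.
Proof.
move=> q0 q1 p0; rewrite /hfun.
have arg_gt0 (r : R) : 0 < 1 + `|r| `^ q / p.
  by rewrite ltr_wpDr// divr_ge0 ?powR_ge0 ?ltW.
rewrite -lnM ?posrE// ler_ln ?posrE ?mulr_gt0//.
have st : `|s + t| `^ q <= `|s| `^ q + `|t| `^ q.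
  rewrite (le_trans _ (powRD_subadditive _ _ _ _ _ _ q0 q1))//.
  by rewrite ge0_ler_powR ?nnegrE ?addr_ge0 ?ler_normD// ltW.
have /ler_wpM2r/(_ _ _ st) : 0 <= p^-1 by rewrite invr_ge0 ltW.
have : 0 <= (`|s| `^ q / p) * (`|t| `^ q / p).
  by rewrite mulr_ge0// divr_ge0 ?powR_ge0 ?ltW.
by rewrite !mulrDl; lra.
Qed.

Lemma hnorm_restr (R : realType) (p q : R) (n : nat) (S : {set 'I_n})
    (x : 'cV[R]_n) : 0 < q ->
  hnorm p q (restr S x) = \sum_(i in S) hfun p q (x i 0).
Proof.
move=> q0; rewrite /hnorm [RHS]big_mkcond; apply: eq_bigr => i _.
by rewrite mxE; case: ifP => // _; rewrite hfun0.
Qed.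

Lemma hnorm_split (R : realType) (p q : R) (n : nat) (S : {set 'I_n})
    (x : 'cV[R]_n) : 0 < q ->
  hnorm p q x = hnorm p q (restr S x) + hnorm p q (restr (~: S) x).
Proof.
move=> q0; rewrite !hnorm_restr// /hnorm (bigID (mem S))/=; congr (_ + _).
by apply: eq_bigl => i; rewrite inE.
Qed.

Lemma hnorm_ge0 (R : realType) (p q : R) (n : nat) (x : 'cV[R]_n) :
  0 < p -> 0 <= hnorm p q x.
Proof. by move=> p0; apply: sumr_ge0 => i _; exact: hfun_ge0. Qed.

Lemma hnormN (R : realType) (p q : R) (n : nat) (x : 'cV[R]_n) :
  hnorm p q (- x) = hnorm p q x.
Proof. by apply: eq_bigr => i _; rewrite mxE hfunN. Qed.

Lemma hnormD (R : realType) (p q : R) (n : nat) (x y : 'cV[R]_n) :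
  0 < q -> q <= 1 -> 0 < p -> hnorm p q (x + y) <= hnorm p q x + hnorm p q y.
Proof.
move=> q0 q1 p0; rewrite /hnorm -big_split/=; apply: ler_sum => i _.
by rewrite mxE hfunD.
Qed.

Lemma restrD (R : realType) (n : nat) (S : {set 'I_n}) (x y : 'cV[R]_n) :
  restr S (x + y) = restr S x + restr S y.
Proof. by apply/matrixP => i j; rewrite !mxE; case: ifP; rewrite ?addr0. Qed.

Lemma restrN (R : realType) (n : nat) (S : {set 'I_n}) (x : 'cV[R]_n) :
  restr S (- x) = - restr S x.
Proof. by apply/matrixP => i j; rewrite !mxE; case: ifP; rewrite ?oppr0. Qed.

(** For fixed [x] and [S] the bound passes to the infimum. If the norm off [S] is positive, the
    quotient of the two norms is a lower bound of all admissible constants. If it is zero, the bound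
    does not depend on the constant, so any admissible [d] settles it. *)
Lemma null_space_constant_attained (R : realType) (p q : R) (m n : nat)
    (A : 'M[R]_(m, n)) (k : nat) : 0 < p ->
  (null_space_constant p q A k < +oo)%E ->
  exists c : R, [/\ null_space_constant p q A k = c%:E, 0 <= c
    & nsc_bound p q A k c].
Proof.
move=> p0 nscoo.
have [_ [d [d0 dA] _] _] := ereal_inf_lt nscoo.
have nsc0 : (0 <= null_space_constant p q A k)%E.
  by apply/ereal_infP => _ [c [c0 _] <-]; rewrite lee_fin.
have nscE : (fine (null_space_constant p q A k))%:E = null_space_constant p q A k.
  by rewrite fineK// ge0_fin_numE.
exists (fine (null_space_constant p q A k)); split => //.
  by rewrite fine_ge0.
move=> x S Ax x0 Sk.
have [Y0|Y0] := eqVneq (hnorm p q (restr (~: S) x)) 0.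
  by have := dA x S Ax x0 Sk; rewrite Y0 !mulr0.
have {}Y0 : 0 < hnorm p q (restr (~: S) x) by rewrite lt_neqAle eq_sym Y0 hnorm_ge0.
rewrite -ler_pdivrMr// -lee_fin nscE; apply/ereal_infP => _ [c [c0 cA] <-].
by rewrite lee_fin ler_pdivrMr// cA.
Qed.

(** Eliminating [yS], [yC] and [xS] leaves [uC <= uS + 2 * xC]. The cone condition absorbs [uS] into
    the left side, which bounds [uC], and then [uS + uC <= (1 + c) * uC]. *)
Lemma error_le_of_cone (R : realFieldType) (c uS uC xS xC yS yC : R) :
  0 <= c -> c < 1 -> yS + yC <= xS + xC ->
  xS <= uS + yS -> uC <= xC + yC -> uS <= c * uC ->
  uS + uC <= 2 * (1 + c) / (1 - c) * xC.
Proof.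
move=> c0 c1 min_le xS_le uC_le uS_le.
have tail : (1 - c) * uC <= 2 * xC by lra.
rewrite mulrAC ler_pdivlMr ?subr_gt0//.
(* The goal is now quadratic in [c]. Scaling [tail] by [1 + c] and the cone condition by [1 - c]
   makes it linear in the resulting monomials. *)
have /ler_wpM2l/(_ _ _ tail) : 0 <= 1 + c by lra.
have /ler_wpM2l/(_ _ _ uS_le) : 0 <= 1 - c by lra.
by lra.
Qed.

Theorem theorem5 (R : realType) (m n k : nat) (A : 'M[R]_(m, n)) (p q : R)
    (xs y : 'cV[R]_n) (S : {set 'I_n}) :
  (0 < k)%N -> (k <= n)%N ->
  0 < q -> q <= 1 -> 0 < p ->
  (null_space_constant p q A k < 1%:E)%E ->
  is_minimizer p q A (A *m xs) y ->
  largest_entries xs k S ->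
  let c := fine (null_space_constant p q A k) in
  hnorm p q (xs - y) <= 2 * (1 + c) / (1 - c) * hnorm p q (restr (~: S) xs).
Proof.
move=> _ _ q0 q1 p0 nsc1 [Ay ymin] [Sk _].
have [c [nscE c0 cA]] := null_space_constant_attained _ _ _ _ _ A k p0
  (lt_trans nsc1 (ltry 1)).
move: nsc1; rewrite nscE lte_fin /= => c1.
move uE : (xs - y) => u.
have Au : A *m u = 0 by rewrite -uE mulmxBr Ay subrr.
have triangleS : hnorm p q (restr S xs) <=
    hnorm p q (restr S u) + hnorm p q (restr S y).
  by rewrite -[in leLHS](subrK y xs) uE restrD hnormD.
have triangleSc : hnorm p q (restr (~: S) u) <=
    hnorm p q (restr (~: S) xs) + hnorm p q (restr (~: S) y).
  by rewrite -uE restrD restrN -[in leRHS](hnormN _ _ _ _ (restr (~: S) y)) hnormD.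
have cone : hnorm p q (restr S u) <= c * hnorm p q (restr (~: S) u).
  (* [nsc_bound] speaks of non-zero kernel vectors only; for [u = 0] both sides vanish. *)
  have [->|u0] := eqVneq u 0.
    have null T : hnorm p q (restr T (0 : 'cV[R]_n)) = 0.
      by rewrite hnorm_restr// big1// => i _; rewrite mxE hfun0.
    by rewrite !null mulr0.
  by apply: cA; rewrite ?Sk.
(* [xs] is itself feasible, so it competes with the minimizer [y]. *)
have := ymin xs erefl.
rewrite (hnorm_split _ _ _ _ S y q0) (hnorm_split _ _ _ _ S xs q0) => min_le.
rewrite (hnorm_split _ _ _ _ S u q0).
exact: error_le_of_cone c0 c1 min_le triangleS triangleSc cone.
Qed.
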